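(* Let $u$ be an upcycle for $\{0,1,\ldots,a-1\}^n$ with diamondicity $d$, and let $k\ge 1$ be an integer. Let $v$ be a cyclic partial word over $\{0,1,\ldots,k-1\}$ with the same length and frame as $u^{(k^{n-d})}$. Then $a\cdot v+u^{(k^{n-d})}$ is an upcycle for $\{0,1,\ldots,ak-1\}^n$ if and only if $v\setminus\diamond$ is a $\left(k,\,n-d,\,\frac{(n-d)a^{n-d}}{n}\right)$-perfect necklace.
   Context: Let $A=\{0,\dots,a-1\}$, $a\ge 2$, be an alphabet and $\diamond\notin A$ a wildcard symbol (''diamond''). A word over $A$ is a finite sequence of letters; a partial word is a finite sequence over $A\cup\{\diamond\}$; a cyclic (partial) word $(u_1\cdots u_N)$ is cyclically ordered, with indices taken modulo $N$. A partial word $x$ covers a partial word $y$ of the same length if for each $i$ either $x_i=\diamond$ or $x_i=y_i$. For $n\ge 1$, the window of $u$ at position $i\in\{1,\dots,N\}$ is $u_i\cdots u_{i+n-1}$. An upcycle for $A^n$ is a cyclic partial word $u=(u_1\cdots u_N)$ such that each word of $A^n$ is covered by the window at exactly one position $i\in\{1,\dots,N\}$. It is known that the diamonds of an upcycle are $n$-periodic ($u_i=\diamond$ implies $u_{i+n}=\diamond$), so all windows contain the same number $d$ of diamonds, called the diamondicity; then $u$ has length $a^{n-d}$ and contains $\frac{d}{n}a^{n-d}$ diamonds. The frame of a (cyclic) partial word is obtained by replacing each letter by a symbol $\bullet$ and keeping each $\diamond$. $u^{(q)}$ denotes the cyclic concatenation of $q$ copies of $u$. For a cyclic partial word $v$ over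 $\{0,\dots,k-1\}$, $a\cdot v$ multiplies each letter by $a$, with $a\cdot\diamond:=\diamond$. For two cyclic partial words of equal length with the same frame, $+$ denotes componentwise addition with $\diamond+\diamond:=\diamond$. $v\setminus\diamond$ is the cyclic word obtained from $v$ by removing all diamonds. An $(a,n,t)$-perfect necklace is a cyclic word $v$ over $\{0,\dots,a-1\}$ of length $t\cdot a^n$ such that for every $j\in\{1,\dots,t\}$, each word of $\{0,\dots,a-1\}^n$ equals $v_iv_{i+1}\cdots v_{i+n-1}$ for a unique $i\in\{1,\dots,ta^n\}$ with $i\equiv j\pmod t$. (In particular the notion makes sense with a one-letter alphabet.) *)

(* Defs.v *)
From mathcomp Require Import all_boot zify.

Set Implicit Arguments.
Unset Strict Implicit.
Unset Printing Implicit Defensive.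

(* A partial word is a sequence of [option nat], the diamond being [None]; the
   alphabet {0, ..., a-1} is imposed by the predicates [word_over] and
   [pword_over].  A cyclic (partial) word is given by a representative sequence,
   read with indices modulo its length and numbered from 0. *)
Definition pword := seq (option nat).

Definition word_over (a : nat) (w : seq nat) : bool := all (fun x => x < a) w.

Definition pword_over (a : nat) (u : pword) : bool :=
  all (oapp (fun x => x < a) true) u.

(* [all2] is false on sequences of different sizes. *)
Definition covers (x y : pword) : bool :=
  all2 (fun xi yi => (xi == None) || (xi == yi)) x y.

(* The window may be longer than the cyclic word, in which case it wraps around
   several times; [x0] is irrelevant as soon as [u] is nonempty. *)
Definition window (T : Type) (x0 : T) (u : seq T) (n i : nat) : seq T :=
  mkseq (fun j => nth x0 u ((i + j) %% size u)) n.

Definition upcycle (a n : nat) (u : pword) : Prop :=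
  pword_over a u /\
  forall w : seq nat, size w = n -> word_over a w ->
    exists! i : 'I_(size u), covers (window None u n i) (map Some w).

Definition has_diamondicity (n : nat) (u : pword) (d : nat) : Prop :=
  forall i : 'I_(size u), count_mem None (window None u n i) = d.

(* The two facts below show that the diamondicity of an upcycle is well
   defined. *)
Lemma upcycle_periodic (a n : nat) (u : pword) :
  1 < a -> 0 < n -> upcycle a n u ->
  forall i, nth None u (i %% size u) = None ->
            nth None u ((i + n) %% size u) = None.
Proof.
move=> a1 n0 [ua up] i ui.
have N0 : 0 < size u.
  have [] := up (nseq n 0); rewrite ?size_nseq //.
    by apply/allP => x; rewrite mem_nseq => /andP[_ /eqP->]; lia.
  by move=> [m ltm] _; lia.
case ex: (nth None u ((i + n) %% size u)) => [x|] //; exfalso.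
pose g j := nth None u ((i + j) %% size u).
pose w' := mkseq (fun j => odflt 0 (g j.+1)) n.-1.
have gl j y : g j = Some y -> y < a.
  move=> gj; move/allP: ua => /(_ (g j)); rewrite gj /=; apply.
  by rewrite -gj mem_nth // ltn_pmod.
have w'a : word_over a w'.
  apply/allP => y /mapP[j _ ->]; case E: (g _) => [z|] /=; last by lia.
  exact: gl E.
have [y [ya yx]] : exists y, y < a /\ y <> x.
  by exists (x == 0 :> nat); case: eqP => /= ?; split; lia.
have sw' : size w' = n.-1 by rewrite size_mkseq.
have [|| p [pc _]] := up (rcons w' y).
- by rewrite size_rcons sw'; lia.
- by rewrite /word_over all_rcons ya.
have coverE q w : size w = n -> reflect (forall j, j < n ->
    (nth None u ((q + j) %% size u) == None) || (nth None u ((q + j) %% size u) == Some (nth 0 w j)))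
    (covers (window None u n q) (map Some w)).
  move=> sw; rewrite /covers all2E !size_map size_iota sw eqxx /=.
  apply: (iffP (all_nthP (None, None))).
    move=> H j jn; have := H j; rewrite size_zip !size_map size_iota sw minnn => /(_ jn).
    rewrite nth_zip ?size_map ?size_iota //=.
    by rewrite nth_mkseq // (nth_map 0) ?sw.
  move=> H j; rewrite size_zip !size_map size_iota sw minnn => jn.
  rewrite nth_zip ?size_map ?size_iota ?sw //=.
  by rewrite nth_mkseq // (nth_map 0) ?sw //; apply: H.
pose q := (p + (size u).-1) %% size u.
pose z := odflt 0 (nth None u q).
have za : z < a.
  rewrite /z; case E: (nth None u q) => [t|] /=; last by lia.
  move/allP: ua => /(_ (Some t)); apply; rewrite -E mem_nth // ltn_pmod //.
have [||r [_ ru]] := up (z :: w').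
- by rewrite /= sw'; lia.
- by rewrite /word_over /= za.
have sz : size (z :: w') = n by rewrite /= sw'; lia.
have hi : (i %% size u) < size u by rewrite ltn_pmod.
have hq : q < size u by rewrite ltn_pmod.
have pq j : (q + j.+1) %% size u = (p + j) %% size u.
  rewrite modnDml (_ : _ + _ = p + j + size u) ?modnDr //; lia.
have r1 : r = Ordinal hi.
  apply: ru; apply/coverE => // -[|j] jn; rewrite /= modnDml.
    by rewrite addn0 ui.
  rewrite nth_mkseq; last by lia.
  by rewrite /g; case: (nth None u _) => [t|] //=; rewrite eqxx.
have r2 : r = Ordinal hq.
  apply: ru; apply/coverE => // -[|j] jn /=.
    rewrite addn0 (modn_small hq) /z; case: (nth None u _) => [t|] //=.
  rewrite pq.
  have sr : size (rcons w' y) = n by rewrite size_rcons sw'; lia.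
  have := elimT (coverE _ _ sr) pc j; rewrite nth_rcons sw'.
  by rewrite ifT; [apply; lia | lia].
have eiq : i %% size u = q by move: r1; rewrite r2 => -[].
have sr : size (rcons w' y) = n by rewrite size_rcons sw'; lia.
have := elimT (coverE _ _ sr) pc n.-1; rewrite nth_rcons sw' ltnn eqxx.
rewrite -pq -eiq modnDml prednK // ex /= => /(_ _)/eqP H.
have [] : Some x = Some y by apply: H; lia.
by move=> e; apply: yx.
Qed.

Lemma upcycle_diamondicity (a n : nat) (u : pword) :
  1 < a -> 0 < n -> upcycle a n u ->
  exists! d, has_diamondicity n u d.
Proof.
move=> a1 n0 uu.
have W := upcycle_periodic a1 n0 uu.
have N0 : 0 < size u.
  case: uu => _ up; have [] := up (nseq n 0); rewrite ?size_nseq //.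
    by apply/allP => x; rewrite mem_nseq => /andP[_ /eqP->]; lia.
  by move=> [m ltm] _; lia.
pose c i := count_mem None (window None u n i).
have cS i : c i <= c i.+1.
  rewrite /c /window; clear c uu; case: n n0 W => // m _ W.
  rewrite [X in _ <= count_mem _ X]mkseqS -cats1 count_cat /= addn0 addn0 addSnnS.
  rewrite -[X in iota X]addn0 iotaDl -map_comp.
  rewrite (@eq_map _ _ _ (fun j => nth None u ((i.+1 + j) %% size u))); last first.
    by move=> j /=; rewrite add1n addSnnS.
  rewrite addnC leq_add2l; case: eqP => // /W ->; by [].
have mono i j : i <= j -> c i <= c j.
  by elim: j => [|j IH]; [case: i | rewrite leq_eqVlt => /orP[/eqP->//|/IH h]; apply: leq_trans (cS j)].
have cN : c (size u) = c 0.
  by rewrite /c /window; congr count; apply: eq_map => j; rewrite modnDl add0n.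
exists (c 0); split.
  move=> i; apply/eqP; rewrite -/(c i) eqn_leq (mono 0 i) // andbT -cN mono //; exact: ltnW.
by move=> d /(_ (Ordinal N0)).
Qed.

Definition frame (u : pword) : seq (option unit) := map (omap (fun=> tt)) u.

Definition ncopies (q : nat) (u : pword) : pword := flatten (nseq q u).

Definition pscale (a : nat) (v : pword) : pword := map (omap (muln a)) v.

(* Meant for words with the same frame: a letter then never meets a diamond. *)
Definition padd (v u : pword) : pword :=
  [seq if p is (Some x, Some y) then Some (x + y) else None | p <- zip v u].

Definition remove_diamonds (v : pword) : seq nat := pmap id v.

Definition perfect_necklace (a n t : nat) (v : seq nat) : Prop :=
  [/\ word_over a v, size v = t * a ^ n
    & forall j, j < t -> forall w : seq nat, size w = n -> word_over a w ->
        exists! i : 'I_(size v), i = j %[mod t] /\ window 0 v n i = w].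

(* Main.v *)
(* Reduce letters modulo a: a word over {0,...,ak-1} is a y + z with y over
   {0,...,k-1} and z over {0,...,a-1}, and it is covered at position i exactly
   when z is covered by u at i and y by v at i.  The first condition fixes i
   modulo N = |u|; the second says that the n - d letters of v seen from
   position i spell the restriction of y to the non-diamonds of that window.
   Removing the diamonds turns i0 + m N into r + m t, where r and t are the
   numbers of letters among the first i0, resp. all N, symbols of u.  Counting
   covered words gives N = a^(n-d), and counting letters over all windows of u
   gives n t = (n-d) N. *)
Require Import Defs.
From mathcomp Require Import all_boot zify.

Set Implicit Arguments.
Unset Strict Implicit.
Unset Printing Implicit Defensive.

(** * Unique existence along residue classes *)

Lemma exists_unique_iff (T : Type) (P Q : T -> Prop) :
  (forall x, P x <-> Q x) -> (exists! x, P x) <-> (exists! x, Q x).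
Proof.
by move=> PQ; split=> -[x [Px Ux]]; exists x; split=> [|y]; firstorder.
Qed.

(** Division by [N] identifies such an index with its quotient m, the remainder being [i0] itself as
    [i0 < N]. This serves both for positions in the lifted word and for positions in the
    necklace. *)
Lemma exists_unique_residue (q N i0 : nat) (P : nat -> Prop) : i0 < N ->
  (exists! i : 'I_(q * N), i = i0 %[mod N] /\ P i) <->
  (exists! m : 'I_q, P (i0 + m * N)).
Proof.
move=> ltN.
have lift (m : 'I_q) : i0 + m * N < q * N by have := ltn_ord m; nia.
have res i : i = i0 %[mod N] -> i = i0 + i %/ N * N.
  by move=> e; rewrite {1}(divn_eq i N) e (modn_small ltN) addnC.
have quo (i : 'I_(q * N)) : i %/ N < q by rewrite ltn_divLR //; lia.
have liftmod m : i0 + m * N = i0 %[mod N] by rewrite addnC modnMDl.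
split=> [[i [[ei Pi] Ui]] | [m [Pm Um]]].
  exists (Ordinal (quo i)); split=> [|m Pm] /=; first by rewrite -res.
  have /= im := congr1 val (Ui (Ordinal (lift m)) (conj (liftmod m) Pm)).
  apply: val_inj => /=; rewrite im addnC divnMDl ?divn_small ?addn0 //; lia.
exists (Ordinal (lift m)); split=> [|i [ei Pi]]; first by split=> //=.
have mi : m = Ordinal (quo i) by apply: Um; rewrite /= -res.
by apply: val_inj; rewrite mi /= -res.
Qed.

Lemma exists_unique_shift (q : nat) (P : nat -> Prop) :
  (forall m, P (m %% q) <-> P m) ->
  (exists! m : 'I_q, P m) -> exists! m : 'I_q, P m.+1.
Proof.
move=> Pmod [m [Pm Um]].
have q0 : 0 < q by case: m {Pm Um} => m; lia.
have lt x : x %% q < q by rewrite ltn_pmod.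
(* The predecessor of [m] modulo [q]; its successor may be [q] itself, which [Pmod] identifies with
   0. *)
exists (Ordinal (lt (m + q.-1))); split=> [|x Px] /=.
  apply/Pmod; rewrite -addn1 modnDml -addnA addn1 prednK // modnDr.
  by rewrite Pmod.
have /= -> := congr1 val (Um (Ordinal (lt x.+1)) (proj2 (Pmod _) Px)).
apply: val_inj => /=.
by rewrite modnDml addSnnS prednK // modnDr modn_small.
Qed.

(** * Cyclic windows as factors of repeated words *)

Section Windows.
Variables (T : Type) (x0 : T).
Implicit Types s : seq T.

Lemma size_window s n i : size (window x0 s n i) = n.
Proof. exact: size_mkseq. Qed.

Lemma nth_flatten_nseq s b i : i < b * size s ->
  nth x0 (flatten (nseq b s)) i = nth x0 s (i %% size s).
Proof.
elim: b i => [|b IH] i //= ib; rewrite nth_cat; case: ltnP => h.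
  by rewrite modn_small.
rewrite IH; last by lia.
by rewrite -[in RHS](subnK h) modnDr.
Qed.

Lemma size_flatten_nseq s b : size (flatten (nseq b s)) = b * size s.
Proof. by elim: b => //= b IH; rewrite size_cat IH mulSn. Qed.

(** With this many copies the window no longer wraps around, so cyclic windows can be handled by
    [take], [drop] and concatenation. *)
Lemma window_take_drop s n i b : i + n <= b * size s ->
  window x0 s n i = take n (drop i (flatten (nseq b s))).
Proof.
move=> ib; apply: (@eq_from_nth _ x0) => [|j].
  by rewrite size_window size_takel // size_drop size_flatten_nseq; lia.
rewrite size_window => jn; rewrite nth_mkseq // nth_take // nth_drop.
by rewrite nth_flatten_nseq //; lia.
Qed.

Lemma window_mod s n i : window x0 s n (i %% size s) = window x0 s n i.
Proof. by apply: eq_map => j; rewrite modnDml. Qed.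

Lemma window_flatten_nseq q s n i : 0 < q ->
  window x0 (flatten (nseq q s)) n i = window x0 s n i.
Proof.
move=> q0; case: (posnP (size s)) => [/size0nil->|s0].
  by rewrite (_ : flatten _ = [::]) //; elim: (q).
apply: eq_map => j; rewrite size_flatten_nseq nth_flatten_nseq.
  by rewrite modn_dvdm // dvdn_mull.
by rewrite ltn_pmod // muln_gt0 q0.
Qed.

Lemma window_cat s n i m :
  window x0 s (m + n) i = window x0 s m i ++ window x0 s n (i + m).
Proof.
rewrite /window /mkseq iotaD map_cat add0n; congr cat.
rewrite -[in LHS](addn0 m) iotaDl -map_comp.
by apply: eq_map => j /=; rewrite addnA.
Qed.

Lemma window_full s : window x0 s (size s) 0 = s.
Proof.
apply: (@eq_from_nth _ x0); rewrite size_window // => i ltis.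
by rewrite nth_mkseq // modn_small.
Qed.

End Windows.

Lemma map_window (T T' : Type) (f : T -> T') x0 s n i :
  map f (window x0 s n i) = window (f x0) (map f s) n i.
Proof.
rewrite /window /mkseq -map_comp; apply: eq_map => j /=.
rewrite size_map; case: (ltnP ((i + j) %% size s) (size s)) => h.
  by rewrite (nth_map x0).
by rewrite !nth_default ?size_map.
Qed.

Lemma all_window (T : Type) (P : pred T) x0 s n i :
  P x0 -> all P s -> all P (window x0 s n i).
Proof.
move=> P0 Ps; rewrite /window /mkseq all_map; apply/allP => j _ /=.
case: (ltnP ((i + j) %% size s) (size s)) => h; first exact: all_nthP.
by rewrite nth_default.
Qed.

Lemma count_mkseq (T : Type) (P : pred T) (f : nat -> T) n :
  count P (mkseq f n) = \sum_(j < n) P (f j).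
Proof.
elim: n => [|n IH]; first by rewrite big_ord0.
by rewrite mkseqS -cats1 count_cat IH big_ord_recr /= addn0.
Qed.

(** Double counting: for each offset j below [n], the rotation sending i to i + j permutes the
    positions, so each offset contributes [count P s]. *)
Lemma sum_count_window (T : Type) (P : pred T) x0 s n : 0 < size s ->
  \sum_(i < size s) count P (window x0 s n i) = n * count P s.
Proof.
move=> s0.
under eq_bigr => i _ do rewrite count_mkseq.
rewrite exchange_big /= -[in RHS](card_ord n) -sum_nat_const.
apply: eq_bigr => j _.
have rotlt (i : 'I_(size s)) : (i + j) %% size s < size s by rewrite ltn_pmod.
pose rot_ord i := Ordinal (rotlt i).
have rot_inj : injective rot_ord.
  move=> i1 i2 /(congr1 val) /= /eqP; rewrite eqn_modDr !modn_small //.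
  by move/eqP/val_inj.
rewrite -sum1_count (big_nth x0) big_mkord [RHS]big_mkcond /=.
by rewrite [RHS](reindex_inj rot_inj).
Qed.

(** * Letters and diamonds: removal, covering, division by [a] *)

Lemma count_isSome (T : eqType) (x : seq (option T)) :
  count isSome x = size x - count_mem None x.
Proof.
by rewrite -(count_predC (pred1 None)) addKn; apply: eq_count => -[].
Qed.

(** Inside enough copies of [v] the window is a factor. Removing diamonds commutes with
    concatenation, and the number of letters among the [i] symbols before the factor gives its new
    starting point. *)
Lemma pmap_id_window (T : Type) (y0 : T) (v : seq (option T)) n i : 0 < size v ->
  pmap id (window None v n i) =
  window y0 (pmap id v) (count isSome (window None v n i))
                        (count isSome (window None v i 0)).
Proof.
(* As [v] is nonempty, i + n copies have length at least i + n. *)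
move=> v0; pose b := i + n; have ib : i + n <= b * size v by rewrite leq_pmulr.
have i0b : 0 + i <= b * size v by lia.
rewrite (window_take_drop None ib) (window_take_drop None i0b) drop0.
set V := flatten _.
have VE : pmap id V = flatten (nseq b (pmap id v)).
  by rewrite /V; elim: (b) => //= c IH; rewrite pmap_cat IH.
have V3 : pmap id V = pmap id (take i V) ++ pmap id (take n (drop i V))
                       ++ pmap id (drop n (drop i V)).
  by rewrite -!pmap_cat !cat_take_drop.
rewrite (@window_take_drop _ _ _ _ _ b).
  by rewrite -VE V3 -!size_pmap drop_size_cat // take_size_cat.
have szp x : size (pmap id x) = count isSome x := size_pmap id x.
by rewrite -size_flatten_nseq -VE V3 !size_cat !szp addnA leq_addr.
Qed.

(** Diamonds impose no condition, so covering only compares the letters of [x] with the entries of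
    [w] at the same places. *)
Lemma covers_map_Some (x : pword) (w : seq nat) : size x = size w ->
  covers x (map Some w) = (pmap id x == mask (map isSome x) w).
Proof.
elim: x w => [|[c|] x IH] [|y w] //= [sxw].
  by rewrite /covers /= -/(covers _ _) IH //= eqseq_cons.
by rewrite /covers /= -/(covers _ _) IH.
Qed.

(** Where the words have letters c and e < a, the equation a c + e = y means c = y / a and e = y mod
    a. Equal frames keep letters from meeting diamonds. *)
Lemma covers_padd_pscale (a : nat) (x z : pword) (w : seq nat) : 0 < a ->
  map isSome x = map isSome z -> pword_over a z -> size w = size z ->
  covers (padd (pscale a x) z) (map Some w) =
  covers x (map Some [seq y %/ a | y <- w]) &&
  covers z (map Some [seq y %% a | y <- w]).
Proof.
rewrite /pword_over => a0; elim: x z w => [|[c|] x IH] [|[e|] z] [|y w] //= [] xz.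
  move=> /andP[ea za] [szw].
  rewrite /covers /= -!/(covers _ _) IH //= -andbACA; congr (_ && _).
  apply/eqP/andP => [[<-]|[/eqP[->] /eqP[->]]].
    rewrite mulnC divnMDl // divn_small // addn0 modnMDl modn_small //.
  by rewrite mulnC -divn_eq.
by move=> za [szw]; rewrite /covers /= -!/(covers _ _) IH.
Qed.

Lemma pword_over_padd_pscale (a k : nat) (x z : pword) :
  pword_over k x -> pword_over a z ->
  pword_over (a * k) (padd (pscale a x) z).
Proof.
rewrite /pword_over /padd /pscale.
elim: x z => [|[c|] x IH] [|[e|] z] //=; last exact: IH.
- by move=> /andP[ck kx] /andP[ea az]; rewrite IH // andbT; nia.
- by move=> /andP[_ kx]; apply: IH.
- by move=> kx /andP[_ az]; apply: IH.
Qed.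

Lemma window_padd_pscale (a : nat) (x z : pword) n i : size x = size z ->
  window None (padd (pscale a x) z) n i =
  padd (pscale a (window None x n i)) (window None z n i).
Proof.
move=> sxz.
have szp s1 s2 : size s1 = size s2 -> size (padd (pscale a s1) s2) = size s2.
  by move=> e; rewrite size_map size_zip size_map e minnn.
apply: (@eq_from_nth _ None) => [|j]; rewrite size_window ?szp ?size_window // => jn.
rewrite nth_mkseq // szp //.
have nthp s1 s2 l : size s1 = size s2 ->
    nth None (padd (pscale a s1) s2) l =
    if (nth None s1 l, nth None s2 l) is (Some c, Some e) then Some (a * c + e) else None.
  elim: s1 s2 l => [|c s1 IH] [|e s2] [|l] //= [] ?; last by rewrite IH.
  by case: c e => [c|] [e|].
by rewrite !nthp ?size_window // !nth_mkseq // sxz.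
Qed.

Lemma mask_surj (T : Type) (P : pred T) (y0 : T) (m : bitseq) (w : seq T) :
  P y0 -> all P w -> size w = count id m ->
  exists y, [/\ size y = size m, all P y & mask m y = w].
Proof.
move=> P0; elim: m w => [|[] m IH] w /=; first by case: w => // _ _; exists [::].
  case: w => // c w /= /andP[Pc Pw] [/(IH _ Pw) [y [sy Py <-]]].
  by exists (c :: y); rewrite /= sy Pc.
move=> Pw /(IH _ Pw) [y [sy Py <-]].
by exists (y0 :: y); rewrite /= sy P0.
Qed.

(** The count over prefixes starts at 0 and grows by at most one per symbol, so it skips no
    value. *)
Lemma count_take_surj (T : Type) (P : pred T) (s : seq T) j :
  j < count P s -> exists2 i, i < size s & count P (take i s) = j.
Proof.
elim: s j => [|c s IH] j //=; case: j => [|j]; first by exists 0.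
case Pc: (P c) => /= js.
  by have [i ? e] := IH j js; exists i.+1; rewrite //= Pc e.
by have [i ? e] := IH j.+1 js; exists i.+1; rewrite //= Pc e.
Qed.

(** * Double counting: length and letters of an upcycle *)

Definition word_of (a n : nat) (f : {ffun 'I_n -> 'I_a}) : seq nat :=
  [seq val (f j) | j <- enum 'I_n].

Lemma size_word_of a n (f : {ffun 'I_n -> 'I_a}) : size (word_of f) = n.
Proof. by rewrite size_map size_enum_ord. Qed.

Lemma nth_word_of a n (f : {ffun 'I_n -> 'I_a}) (j : 'I_n) :
  nth 0 (word_of f) j = f j.
Proof. by rewrite (nth_map j) ?size_enum_ord // nth_ord_enum. Qed.

Lemma word_over_word_of a n (f : {ffun 'I_n -> 'I_a}) : word_over a (word_of f).
Proof. by apply/allP => _ /mapP[j _ ->]; apply: ltn_ord. Qed.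

(** Positions are independent: [a] choices under a diamond, one under a letter. The covered words
    thus form a [family], whose cardinality is a product. *)
Lemma card_covered (a n : nat) (x : pword) : size x = n -> pword_over a x ->
  #|[pred f : {ffun 'I_n -> 'I_a} | covers x (map Some (word_of f))]|
  = a ^ count_mem None x.
Proof.
move=> sx ax.
pose F (j : 'I_n) := [pred c : 'I_a |
  (nth None x j == None) || (nth None x j == Some (val c))].
have -> : #|[pred f : {ffun 'I_n -> 'I_a} | covers x (map Some (word_of f))]|
        = #|family F|.
  apply: eq_card => f; rewrite unfold_in /= /covers all2E size_map sx.
  have szip : size (zip x (map Some (word_of f))) = n.
    by rewrite size_zip size_map size_word_of sx minnn.
  have nthz (j : 'I_n) : nth (None, None) (zip x (map Some (word_of f))) j =
                         (nth None x j, Some (val (f j))).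
    rewrite nth_zip /=; last by rewrite size_map size_word_of.
    by rewrite (nth_map 0) ?nth_word_of ?size_word_of.
  rewrite size_word_of eqxx /=.
  apply/(all_nthP (None, None))/familyP => [H j|H j].
    by have := H j; rewrite szip nthz; apply.
  by rewrite szip => jn; have := H (Ordinal jn); rewrite (nthz (Ordinal jn)).
have cardF j : #|F j| = if nth None x j == None then a else 1.
  rewrite /F; case E: (nth None x j) => [c|] /=.
    have ca : c < a.
      have := elimT (all_nthP None) ax j; rewrite sx ltn_ord E; exact.
    by rewrite -(card1 (Ordinal ca)); apply: eq_card => e; rewrite !inE eq_sym.
  by rewrite -[RHS](card_ord a); apply: eq_card.
rewrite card_family foldrE big_map big_enum /=.
under eq_bigr => j _ do rewrite cardF.
rewrite -big_mkcond prod_nat_const /=; congr (_ ^ _).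
rewrite -sum1_card -sum1_count (big_nth None) big_mkord sx.
exact: eq_bigl.
Qed.

Section Upcycle.
Variables (a n d : nat) (u : pword).
Hypothesis ha : 1 < a.
Hypotheses (hu : upcycle a n u) (hd : has_diamondicity n u d).

Lemma upcycle_size_gt0 : 0 < size u.
Proof.
case: hu => _ /(_ (nseq n 0)); rewrite size_nseq => /(_ erefl) [].
  by apply/allP => x; rewrite mem_nseq => /andP[_ /eqP->]; apply: ltnW.
by case=> m ltm _; apply: leq_ltn_trans ltm.
Qed.

Lemma count_None_window i : count_mem None (window None u n i) = d.
Proof.
rewrite -window_mod.
exact: (hd (Ordinal (ltn_pmod i upcycle_size_gt0))).
Qed.

Lemma diamondicity_le : d <= n.
Proof.
have := count_size (pred1 None) (window None u n 0).
by rewrite count_None_window size_window.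
Qed.

Lemma pword_over_window i : pword_over a (window None u n i).
Proof. by case: hu => ua _; apply: all_window. Qed.

(** Count the pairs of a position and a word covered there: each position covers a^d words, and each
    of the a^n words is covered once. *)
Lemma upcycle_size : size u = a ^ (n - d).
Proof.
have a0 : 0 < a := ltnW ha.
have covered (i : 'I_(size u)) : a ^ d = \sum_(f : {ffun 'I_n -> 'I_a})
    covers (window None u n i) (map Some (word_of f)).
  rewrite -(count_None_window i).
  rewrite -(card_covered (size_window None u n i) (pword_over_window i)).
  by rewrite -sum1_card big_mkcond.
have H : size u * a ^ d = a ^ n.
  rewrite -[in LHS](card_ord (size u)) -sum_nat_const (eq_bigr _ (fun i _ => covered i)).
  rewrite exchange_big /= -[in RHS](card_ord a) -[in RHS](card_ord n) -card_ffun.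
  rewrite -sum1_card; apply: eq_bigr => f _.
  case: hu => _ /(_ _ (size_word_of f) (word_over_word_of f)) [i [ci Ui]].
  rewrite (bigD1 i) //= ci big1 // => i' ni.
  by apply/eqP; rewrite eqb0; apply: contraNN ni => /Ui ->.
apply/eqP; rewrite -(@eqn_pmul2r (a ^ d)) ?expn_gt0 ?a0 //.
by rewrite H -expnD subnK // diamondicity_le.
Qed.

Lemma count_letters_window i : count isSome (window None u n i) = n - d.
Proof. by rewrite count_isSome size_window count_None_window. Qed.

(** Sum the letters over all windows: each window has n - d of them, and each letter of [u] is
    counted n times. *)
Lemma upcycle_letters : n * count isSome u = (n - d) * size u.
Proof.
rewrite -(sum_count_window _ None) ?upcycle_size_gt0 //.
under eq_bigr => i _ do rewrite count_letters_window.
by rewrite sum_nat_const card_ord mulnC.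
Qed.

End Upcycle.

(* The window of length i at 0 is the prefix of length i of the periodic word
   u u u ..., so [rank u i] also counts letters when i exceeds [size u]. *)
Definition rank (u : pword) (i : nat) : nat := count isSome (window None u i 0).

(** * Letter ranks, and words with given quotients and remainders *)

Lemma rank_mulD (u : pword) m i :
  rank u (i + m * size u) = rank u i + m * count isSome u.
Proof.
elim: m => [|m IH]; first by rewrite !addn0.
rewrite (_ : i + _ = size u + (i + m * size u)); last by lia.
rewrite /rank window_cat window_full count_cat -window_mod add0n modnn.
by rewrite -/(rank _ _) IH -/(rank u i) mulSn addnCA.
Qed.

Lemma rank_take (u : pword) i : i <= size u -> rank u i = count isSome (take i u).
Proof.
move=> iu; rewrite /rank (@window_take_drop _ _ _ _ _ 1) ?mul1n //=.
by rewrite cats0 drop0.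
Qed.

(** Provides a word that [u] covers at a prescribed position. *)
Lemma covers_odflt (x : pword) : covers x (map Some (map (odflt 0) x)).
Proof.
by elim: x => [|[c|] x IH] //=; rewrite /covers /= ?eqxx.
Qed.

Lemma combine_digits (a k : nat) (y z : seq nat) : size y = size z ->
  word_over k y -> word_over a z ->
  exists x, [/\ size x = size z, word_over (a * k) x,
                [seq c %/ a | c <- x] = y & [seq c %% a | c <- x] = z].
Proof.
rewrite /word_over; elim: y z => [|c y IH] [|e z] //=; first by exists [::].
move=> [syz] /andP[ck ky] /andP[ea az].
have [x [<- xak <- <-]] := IH _ syz ky az.
exists (a * c + e :: x); split=> //=.
- by rewrite xak andbT; nia.
- by rewrite mulnC divnMDl ?divn_small ?addn0 //; lia.
- by rewrite mulnC modnMDl modn_small.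
Qed.

(** * The lifted word against the necklace *)

Section Lift.
Variables (a n d k : nat) (u v : pword).
Hypotheses (ha : 1 < a) (hk : 0 < k).
Hypotheses (hu : upcycle a n u) (hd : has_diamondicity n u d).
Hypothesis (hv : pword_over k v).
Let q := k ^ (n - d).
Hypothesis (hframe : frame v = frame (ncopies q u)).
Let N := size u.
Let L := count isSome u.
Let lift := padd (pscale a v) (ncopies q u).
Let necklace := remove_diamonds v.

Let q_gt0 : 0 < q. Proof. by rewrite expn_gt0 hk. Qed.

Let size_v : size v = q * N.
Proof.
by rewrite -(size_map (omap (fun=> tt))) -/(frame v) hframe size_map size_flatten_nseq.
Qed.

Let isSome_v : map isSome v = map isSome (ncopies q u).
Proof.
have isSome_frame x : map isSome x = map isSome (frame x).
  by rewrite -map_comp; apply: eq_map => -[].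
by rewrite isSome_frame hframe -isSome_frame.
Qed.

Let isSome_window l i :
  map isSome (window None v l i) = map isSome (window None u l i).
Proof.
by rewrite map_window isSome_v -map_window window_flatten_nseq.
Qed.

Let count_window l i :
  count isSome (window None v l i) = count isSome (window None u l i).
Proof. by rewrite -!(count_map isSome id) isSome_window. Qed.

Let size_necklace : size necklace = q * L.
Proof.
rewrite size_pmap -(window_full None v) count_window size_v -[_ * _]add0n.
by rewrite -/(rank u _) rank_mulD.
Qed.

(** As [v] repeats the frame of [u], [rank u i] letters precede position [i], and every window of
    length n has n - d letters. *)
Let pmap_window_v i :
  pmap id (window None v n i) = window 0 necklace (n - d) (rank u i).
Proof.
have v0 : 0 < size v by rewrite size_v muln_gt0 q_gt0 (upcycle_size_gt0 ha hu).
by rewrite (pmap_id_window 0) // !count_window (count_letters_window ha hu hd).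
Qed.

Let pword_over_copies : pword_over a (ncopies q u).
Proof.
case: hu => ua _; rewrite /ncopies /pword_over.
by elim: (q) => //= b IH; rewrite all_cat IH andbT; apply: ua.
Qed.

Let size_lift : size lift = q * N.
Proof. by rewrite size_map size_zip size_map size_v size_flatten_nseq minnn. Qed.

(** The remainders of [x] are covered by [u] at [i0] only, which fixes [i] modulo [N]; the letters
    of [v] seen from [i] must then match the quotients. *)
Let covers_lift (i0 i : nat) (x : seq nat) :
  i0 < N -> size x = n -> word_over (a * k) x ->
  covers (window None u n i0) (map Some [seq c %% a | c <- x]) ->
  covers (window None lift n i) (map Some x) <->
  i = i0 %[mod N] /\
  window 0 necklace (n - d) (rank u i) =
    mask (map isSome (window None u n i0)) [seq c %/ a | c <- x].
Proof.
move=> ltN sx xak ci0.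
have a0 : 0 < a := ltnW ha.
have N0 : 0 < N by lia.
have ui := pword_over_window hu i.
rewrite /lift window_padd_pscale ?size_v ?size_flatten_nseq //.
rewrite window_flatten_nseq // covers_padd_pscale ?isSome_window ?size_window //.
rewrite covers_map_Some ?size_window ?size_map // pmap_window_v isSome_window.
have umod : i = i0 %[mod N] -> window None u n i = window None u n i0.
  by move=> e; rewrite -window_mod -/N e window_mod.
split=> [/andP[/eqP pi ci]|[e ->]]; last by rewrite umod // eqxx.
suff e : i = i0 %[mod N] by rewrite pi umod.
have za : word_over a [seq c %% a | c <- x].
  by apply/allP => _ /mapP[c _ ->]; rewrite ltn_mod.
case: hu => _ /(_ [seq c %% a | c <- x]); rewrite size_map => /(_ sx za) [j [_ Uj]].
have <- : val j = i %% N.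
  rewrite (Uj (Ordinal (ltn_pmod i N0))) //=.
  by rewrite -/N window_mod.
by rewrite modn_small // (Uj (Ordinal ltN)).
Qed.

(** Common form of both sides: for r = [rank u i0], the number [r + m * L] is the rank of position
    i0 + m N. *)
Let reads (r : nat) (w : seq nat) : Prop :=
  exists! m : 'I_q, window 0 necklace (n - d) (r + m * L) = w.

(** The remainders of a word select [i0] and its quotients select [w]; conversely every pair ([i0],
    [w]) arises from some word. *)
Let upcycle_lift : upcycle (a * k) n lift <->
  forall i0, i0 < N -> forall w, size w = n - d -> word_over k w ->
    reads (rank u i0) w.
Proof.
have a0 : 0 < a := ltnW ha.
have readsE i0 x : i0 < N -> size x = n -> word_over (a * k) x ->
    covers (window None u n i0) (map Some [seq c %% a | c <- x]) ->
    (exists! i : 'I_(size lift), covers (window None lift n i) (map Some x)) <->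
    reads (rank u i0) (mask (map isSome (window None u n i0)) [seq c %/ a | c <- x]).
  move=> ltN sx xak ci0; set w := mask _ _.
  pose P i := window 0 necklace (n - d) (rank u i) = w.
  rewrite size_lift.
  apply: iff_trans (_ : (exists! i : 'I_(q * N), i = i0 %[mod N] /\ P i) <-> _).
    by apply: exists_unique_iff => i; apply: covers_lift.
  apply: (iff_trans (exists_unique_residue q P ltN)).
  by apply: exists_unique_iff => m; rewrite /P rank_mulD.
split=> [[_ up] i0 ltN w sw wk | H].
  (* A word that tests ([i0], [w]): its quotients [y] spell [w] at the letters of the window, and
     its remainders are the window with 0 in place of diamonds. *)
  have [|y [sy yk <-]] := @mask_surj _ (fun c => c < k) 0
                            (map isSome (window None u n i0)) w hk wk.
    by rewrite count_map sw -(count_letters_window ha hu hd i0); apply: eq_count.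
  have [|||x [sx xak xy xz]] := @combine_digits a k y (map (odflt 0) (window None u n i0)).
  - by rewrite sy !size_map.
  - exact: yk.
  - have := pword_over_window hu i0; rewrite /word_over all_map.
    by apply: sub_all => -[].
  rewrite size_map size_window in sx.
  have := covers_odflt (window None u n i0); rewrite -xz => ci0.
  by rewrite -xy; apply/(readsE _ _ ltN sx xak ci0)/up.
split=> [|x sx xak]; first exact: pword_over_padd_pscale.
have yk : word_over k [seq c %/ a | c <- x].
  apply/allP => _ /mapP[c /(allP xak) cak ->].
  by rewrite ltn_divLR // mulnC.
have za : word_over a [seq c %% a | c <- x].
  by apply/allP => _ /mapP[c _ ->]; rewrite ltn_mod.
case: hu => _ /(_ [seq c %% a | c <- x]); rewrite size_map => /(_ sx za) [i0 [ci0 _]].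
apply/(readsE _ _ (ltn_ord i0) sx xak ci0)/H => //.
  rewrite size_mask; last by rewrite !size_map size_iota.
  rewrite count_map.
  exact: (count_letters_window ha hu hd).
by apply/allP => c /mem_mask; apply: (allP yk).
Qed.

Let necklaceE : perfect_necklace k (n - d) L necklace <->
  forall j, j < L -> forall w, size w = n - d -> word_over k w -> reads j w.
Proof.
have readsE j w : j < L ->
    (exists! i : 'I_(size necklace),
       i = j %[mod L] /\ window 0 necklace (n - d) i = w) <-> reads j w.
  move=> ltL; rewrite size_necklace.
  exact: (@exists_unique_residue q L j (fun i => window 0 necklace (n - d) i = w)).
split=> [[_ _ H] j ltL w sw wk|H]; first exact/readsE/H.
split; last by move=> j ltL w sw wk; apply/readsE/H.
  apply/allP => c; rewrite mem_pmap map_id => cv.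
  exact: (allP hv _ cv).
by rewrite size_necklace mulnC.
Qed.

(** Both sides reduce to [reads]. The ranks of positions below [N] include every j < [L]; the only
    other possible value is [L], when no letter stands at or after the position. *)
Lemma upcycle_lift_necklace :
  upcycle (a * k) n lift <-> perfect_necklace k (n - d) L necklace.
Proof.
apply: (iff_trans upcycle_lift); apply: (iff_trans _ (iff_sym necklaceE)).
split=> [H j ltL|H i0 ltN w sw wk].
  have [i0 ltN <-] := count_take_surj ltL.
  by rewrite -rank_take ?(ltnW ltN) //; apply: H.
have : rank u i0 <= L.
  by rewrite rank_take ?(ltnW ltN) // /L -{2}(cat_take_drop i0 u) count_cat leq_addr.
rewrite leq_eqVlt => /orP[/eqP rL|]; last by move=> ltL; apply: H.
(* Here only diamonds follow position i0 in u: position i0 + m N is then read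
   like position (m+1) N. *)
have [L0|L0] := posnP L.
  (* Without letters in [u], the identity n L = (n - d) N with N > 0 forces n - d = 0: the only word
     is empty and there is one index m. *)
  have nd0 : n - d = 0.
    have := upcycle_letters ha hu hd; have := upcycle_size_gt0 ha hu.
    rewrite -/L L0; case: (n - d) => // m; lia.
  have q1 : q = 1 by rewrite /q nd0.
  rewrite /reads q1 nd0; rewrite nd0 in sw; rewrite (size0nil sw).
  by exists ord0; split=> // m _; rewrite [m]ord1.
have := H 0 L0 w sw wk; rewrite /reads rL.
(* The necklace has length q L, so m matters only modulo q and passing from m to m + 1 permutes the
   indices. *)
have mod_q m : window 0 necklace (n - d) (m %% q * L) = w <->
               window 0 necklace (n - d) (m * L) = w.
  rewrite -(window_mod _ necklace _ (m * L)) -(window_mod _ necklace _ (m %% q * L)).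
  by rewrite size_necklace -!muln_modl modn_mod.
exact: (exists_unique_shift mod_q).
Qed.

End Lift.

Theorem theorem5p1 (a n d k : nat) (u v : pword)
    (ha : 2 <= a) (hn : 1 <= n) (hk : 1 <= k)
    (hu : upcycle a n u) (hd : has_diamondicity n u d)
    (hv : pword_over k v)
    (hframe : frame v = frame (ncopies (k ^ (n - d)) u)) :
  upcycle (a * k) n (padd (pscale a v) (ncopies (k ^ (n - d)) u)) <->
  perfect_necklace k (n - d) (((n - d) * a ^ (n - d)) %/ n) (remove_diamonds v).
Proof.
(* The dividend is n times [count isSome u], so the division is exact. *)
have -> : (n - d) * a ^ (n - d) %/ n = count isSome u.
  by rewrite -(upcycle_size ha hu hd) -(upcycle_letters ha hu hd) mulKn.
exact: upcycle_lift_necklace.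
Qed.
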